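(* Let $G$ be a connected graph of order $n$ with maximum degree $\Delta(G)$. If $G$ has at least two cut vertices and $n-4\le \Delta(G)\le n-2$, then $vcfc(G)=3$.
   Context: Vertex-colorings are arbitrary, not necessarily proper. A path in a vertex-colored graph is called conflict-free if there is a color used on exactly one of its vertices. A vertex-colored graph is conflict-free vertex-connected if any two vertices of the graph are connected by a conflict-free path. For a connected graph $G$, the conflict-free vertex-connection number $vcfc(G)$ is the smallest number of colors needed in a vertex-coloring of $G$ that makes $G$ conflict-free vertex-connected. *)

(* Defs.v *)
(* A finite simple graph is a symmetric irreflexive relation
   [e] on a finType [T]. *)
From mathcomp Require Import all_boot.

Set Implicit Arguments.
Unset Strict Implicit.
Unset Printing Implicit Defensive.

Section Graphs.

Variables (T : finType) (e : rel T).

Definition degree (x : T) : nat := #|[set y | e x y]|.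

Definition max_degree : nat := \max_(x : T) degree x.

Definition connected_graph : Prop := forall x y : T, connect e x y.

Definition delete_vertex (v : T) : rel T :=
  [rel x y | [&& x != v, y != v & e x y]].

(* Deleting v increases the number of connected components.  As a relation on
   T, [delete_vertex v] leaves v isolated, hence the count over [predC1 v]. *)
Definition cut_vertex (v : T) : bool :=
  n_comp e T < n_comp (delete_vertex v) (predC1 v).

Definition simple_path (x y : T) (p : seq T) : bool :=
  [&& path e x p, uniq (x :: p) & last x p == y].

Definition conflict_free (k : nat) (c : T -> 'I_k) (s : seq T) : bool :=
  [exists a : 'I_k, count_mem a [seq c z | z <- s] == 1].

(* A simple path has at most #|T| vertices, so bounded sequences suffice; this
   makes the predicate decidable (see [cf_connectedP]).  The case x = y is
   harmless: the one-vertex path is conflict-free. *)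
Definition cf_connected (k : nat) (c : T -> 'I_k) : bool :=
  [forall x : T, forall y : T, exists p : {bseq #|T| of T},
     simple_path x y p && conflict_free c (x :: p)].

Lemma cf_connectedP (k : nat) (c : T -> 'I_k) :
  reflect (forall x y : T, exists2 p : seq T,
             simple_path x y p & conflict_free c (x :: p))
          (cf_connected c).
Proof.
apply: (iffP forallP) => [H x y | H x].
  by have /existsP[p /andP[p1 p2]] := forallP (H x) y; exists (val p).
apply/forallP => y; have [p p1 p2] := H x y.
have szp : size p <= #|T|.
  by case/and3P: p1 => _ /card_uniqP /= E _; rewrite ltnW // -E max_card.
by apply/existsP; exists (Bseq szp); rewrite p1.
Qed.

Definition cf_colorable (k : nat) : bool :=
  [exists c : {ffun T -> 'I_k}, cf_connected c].

Lemma cf_colorable_ex : connected_graph -> exists k : nat, cf_colorable k.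
Proof.
move=> conn; exists #|T|; apply/existsP; exists [ffun x => enum_rank x].
apply/cf_connectedP => x y; have /connectP[p0 e_p0 ->] := conn x y.
case/shortenP: e_p0 => p e_p Up _; exists p; first by rewrite /simple_path e_p Up /=.
apply/existsP; exists (enum_rank x); apply/eqP.
rewrite (eq_map (ffunE _)) count_uniq_mem ?map_inj_uniq //; last exact: enum_rank_inj.
by rewrite map_f ?mem_head.
Qed.

Definition vcfc (conn : connected_graph) : nat :=
  ex_minn (cf_colorable_ex conn).

End Graphs.

(* Main.v *)
Require Import Defs.
From mathcomp Require Import all_boot.

(** Lower bound.  Let [u], [v] be two cut vertices, [A] a component of [G - u]
    avoiding [v] and [B] a component of [G - v] avoiding [u].  A conflict-free
    path from [A] to [u] stays in [A] plus [u], so some [a] in [A] is not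
    coloured like [u]; likewise some [b] in [B] is not coloured like [v].  Every
    path from [a] to [b] runs through [u] and [v], hence with at most two
    colours it meets each colour in both [{a, u}] and [{b, v}].

    Upper bound.  If the vertices other than [z] split into stars, each with a
    vertex adjacent to [z], then three colours suffice: one for [z], one for the
    centres and one for the rest.  Such a [z] is found at, or next to, a vertex
    [x] of maximum degree, since at most three vertices are not in [N[x]]. *)

Section ConflictFree.

Set Implicit Arguments.
Unset Strict Implicit.

Variables (T : finType) (e : rel T).
Hypotheses (e_sym : symmetric e) (e_irr : irreflexive e).

(** * Paths and components after deletion of a vertex *)

Lemma delete_vertex_sym v : symmetric (delete_vertex e v).
Proof. by move=> x y; rewrite /delete_vertex /= e_sym andbCA. Qed.

Lemma delete_vertex_connectC v : connect_sym (delete_vertex e v).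
Proof. exact/sym_connect_sym/delete_vertex_sym. Qed.

Lemma path_delete_vertex v x p :
  path e x p -> v \notin x :: p -> path (delete_vertex e v) x p.
Proof.
rewrite /delete_vertex; elim: p x => //= y p IHp x /andP[exy yp]; rewrite !inE !negb_or.
move=> /and3P[xv yv vp]; rewrite eq_sym xv eq_sym yv exy /=.
by apply: IHp => //; rewrite inE negb_or yv.
Qed.

(** The part of the path up to [a] misses [y], since [y] comes last and a simple path does not
    repeat it. *)
Lemma connect_before_end x y p a :
  simple_path e x y p -> a \in x :: p -> a != y ->
  connect (delete_vertex e y) x a.
Proof.
case/and3P=> + + /eqP.
move=> + + + ap; case/splitPl: ap => p1 p2 <-.
rewrite cat_path last_cat -cat_cons cat_uniq => /andP[ep1 _] /and3P[_ p12 _].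
case: p2 p12 => [|b p2] p12 /= last2 ne; first by rewrite last2 eqxx in ne.
apply/connectP; exists p1 => //; apply: path_delete_vertex => //.
by apply: contra p12 => yp1; apply/hasP; exists y; rewrite // -last2 mem_last.
Qed.

(** Otherwise every vertex but [u] lies in the component of [v], so deleting [u] leaves a single
    component, and the number of components has not grown. *)
Lemma cut_vertex_separates u v : cut_vertex e u -> v != u ->
  exists2 a, a != u & ~~ connect (delete_vertex e u) v a.
Proof.
move=> cut_u vu.
have [/existsP[a /andP[au na]] | /existsPn no_a] :=
  boolP [exists a, (a != u) && ~~ connect (delete_vertex e u) v a].
  by exists a.
have e_csym : connect_sym e := sym_connect_sym e_sym.
suff: n_comp (delete_vertex e u) (predC1 u) <= n_comp e T.
  by move: cut_u; rewrite /cut_vertex ltnNge => /negbTE->.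
have single : predC1 u =i connect (delete_vertex e u) v.
  move=> a; rewrite !inE; have := no_a a; rewrite negb_and !negbK.
  have [-> _ | _ /= ->//] := eqVneq a u.
  apply/esym/negbTE/negP; rewrite delete_vertex_connectC => /connectP[[|b p]].
    by move=> _ vE; rewrite vE eqxx in vu.
  by rewrite /delete_vertex /= eqxx.
rewrite (eq_n_comp_r single) (n_comp_connect (delete_vertex_connectC u)).
apply/card_gt0P; exists (root e v).
by rewrite !inE /= roots_root.
Qed.

(** * The lower bound: two colours do not suffice *)

(** On a monochromatic path with at least two vertices, one colour occurs at least twice and the
    others never. *)
Lemma conflict_free_nonconstant k (c : T -> 'I_k) x y p :
  x != y -> simple_path e x y p -> conflict_free c (x :: p) ->
  exists2 a, a \in x :: p & c a != c y.
Proof.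
move=> xy /and3P[_ _ /eqP lastp] /existsP[i /eqP].
have [/hasP[a] | /hasPn same] := boolP (has (fun a => c a != c y) (x :: p)).
  by exists a.
rewrite count_map; case: (eqVneq (c y) i) => [<- | ci].
  rewrite (eq_in_count (a2 := predT)) => [|a /same /negPn//].
  rewrite count_predT; case: p lastp {same} => //= yE.
  by rewrite yE eqxx in xy.
rewrite (eq_in_count (a2 := pred0)) ?count_pred0 // => a /same /negPn /eqP /= ->.
exact/negbTE.
Qed.

(** Apply the previous lemma to a conflict-free path to [u] from a vertex that [u] separates from
    [v]: before its end, the path stays in the component of its start in [G - u]. *)
Lemma cut_side_color k (c : T -> 'I_k) u v : cf_connected e c ->
  cut_vertex e u -> v != u ->
  exists a, [/\ a != u, ~~ connect (delete_vertex e u) v a & c a != c u].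
Proof.
move=> /cf_connectedP cf cut_u vu.
have [a0 a0u va0] := cut_vertex_separates cut_u vu.
have [p sp cfp] := cf a0 u.
have [a ap ca] := conflict_free_nonconstant a0u sp cfp.
have au : a != u by apply: contraNneq ca => ->.
exists a; split=> //; apply: contra va0 => va.
apply: connect_trans va _; rewrite delete_vertex_connectC.
exact: connect_before_end sp ap au.
Qed.

Lemma count_color_gt1 k (c : T -> 'I_k) s i x y :
  uniq s -> x \in s -> y \in s -> x != y -> c x = i -> c y = i ->
  1 < count_mem i [seq c z | z <- s].
Proof.
move=> Us xs ys xy cx cy; rewrite count_map -size_filter.
apply: (@uniq_leq_size _ [:: x; y]); first by rewrite /= inE xy.
by move=> t; rewrite !inE mem_filter /= => /orP[] /eqP->; rewrite ?cx ?cy eqxx.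
Qed.

Lemma connect_avoiding v x y p :
  simple_path e x y p -> v \notin x :: p -> connect (delete_vertex e v) x y.
Proof.
case/and3P=> ep _ /eqP lastp vp; apply/connectP; exists p => //.
exact: path_delete_vertex.
Qed.

Lemma two_cut_vertices_colorable u v k : connected_graph e ->
  u != v -> cut_vertex e u -> cut_vertex e v -> cf_colorable e k -> 2 < k.
Proof.
move=> conn uv cut_u cut_v /existsP[c cf]; rewrite ltnNge; apply/negP => k2.
have vu : v != u by rewrite eq_sym.
have /cf_connectedP cfP := cf.
have [a [au nva ca]] := cut_side_color cf cut_u vu.
have [b [bv nub cb]] := cut_side_color cf cut_v uv.
(* A path from [d] to [w1] has to meet [w2], and its part up to [w2] avoids [w1]. *)
have across w1 w2 d : w1 != w2 -> d != w2 ->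
    ~~ connect (delete_vertex e w2) w1 d -> connect (delete_vertex e w1) d w2.
  move=> w12 dw2 nd; have [p sp _] := cfP d w1.
  apply: (connect_before_end sp); last by rewrite eq_sym.
  apply: contraNT nd => w2p.
  by rewrite delete_vertex_connectC (connect_avoiding sp).
have conn_bv := across u v b uv bv nub.
have conn_au := across v u a vu au nva.
have av : a != v by apply: contraNneq nva => ->.
have bu : b != u by apply: contraNneq nub => ->.
have ab : a != b by apply: contraNneq nva => ->; rewrite delete_vertex_connectC.
have [p sp /existsP[i]] := cfP a b.
have up : u \in a :: p.
  apply: contraNT nva => up; rewrite delete_vertex_connectC.
  exact: connect_trans (connect_avoiding sp up) conn_bv.
have vp : v \in a :: p.
  apply: contraNT nub => vp; rewrite delete_vertex_connectC in conn_au.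
  exact: connect_trans conn_au (connect_avoiding sp vp).
have bp : b \in a :: p by case/and3P: sp => _ _ /eqP<-; apply: mem_last.
have ap : a \in a :: p by rewrite mem_head.
have Up : uniq (a :: p) by case/and3P: sp.
(* With at most two colours, any two distinct ones include the unique colour [i]. *)
have two_colors (x y : T) : c x != c y -> (c x == i) || (c y == i).
  rewrite -!val_eqE /=.
  have small (t : 'I_k) : t < 2 := leq_trans (ltn_ord t) k2.
  case: (nat_of_ord (c x)) (small (c x)) => [|[|//]] _;
    case: (nat_of_ord (c y)) (small (c y)) => [|[|//]] _ //;
    by case: (nat_of_ord i) (small i) => [|[|//]].
(* Colour [i] occurs in [{a, u}] and in [{b, v}]; these pairs are disjoint and both lie on the path,
   so [i] is used at least twice. *)
move=> /eqP cnt1; case/orP: (two_colors _ _ ca) => /eqP c1;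
  case/orP: (two_colors _ _ cb) => /eqP c2;
  suff: 1 < count_mem i [seq c z | z <- a :: p] by rewrite cnt1.
- exact: (@count_color_gt1 _ _ _ _ a b).
- exact: (@count_color_gt1 _ _ _ _ a v).
- by apply: (@count_color_gt1 _ _ _ _ u b) => //; rewrite eq_sym.
- exact: (@count_color_gt1 _ _ _ _ u v).
Qed.

(** * The upper bound: colouring a partition into stars *)

(* [f] sends a vertex to the centre of its star. *)
Lemma star_partition_colorable z (f : T -> T) : connected_graph e ->
  (forall v, v != z -> [/\ f v != z, f (f v) = f v & (f v == v) || e v (f v)]) ->
  (forall v, v != z -> exists y, [/\ y != z, f y = f v & e y z]) ->
  cf_colorable e 3.
Proof.
move=> conn fP zP.
pose c v : 'I_3 := if v == z then inord 2 else if f v == v then inord 1 else inord 0.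
have cz v : (c v == inord 2) = (v == z).
  by rewrite /c -val_eqE /=; do 2?case: ifP => _; rewrite !inordK.
apply/existsP; exists (finfun c); apply/cf_connectedP => u v.
have cE (p : seq T) : conflict_free (finfun c) p = conflict_free c p.
  by rewrite /conflict_free (eq_map (ffunE c)).
suff [p] : exists2 p, simple_path e u v p & conflict_free c (u :: p).
  by exists p; rewrite ?cE.
have through_z p : uniq p -> z \in p -> conflict_free c p.
  move=> Up zp; apply/existsP; exists (inord 2).
  by rewrite count_map (eq_count cz) count_uniq_mem // zp.
have [uz | uz] := eqVneq u z.
  have /connectP[p0 ep0 ->] := conn u v; case/shortenP: ep0 => p ep Up _.
  exists p; first by rewrite /simple_path ep Up /=.
  by apply: through_z => //; rewrite uz mem_head.
have [vz | vz] := eqVneq v z.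
  have /connectP[p0 ep0 vE] := conn u v; case/shortenP: ep0 vE => p ep Up _ vE.
  exists p; first by rewrite /simple_path ep Up vE /=.
  by apply: through_z => //; rewrite -vz vE mem_last.
have [fuz ffu fu] := fP u uz; have [fvz ffv fv] := fP v vz.
(* Within one star, a path of at most three vertices through the centre works: the centre alone has
   colour 1. *)
have [fuv | fuv] := eqVneq (f u) (f v).
  have [uv | uv] := eqVneq u v.
    exists [::]; first by rewrite /simple_path /= uv eqxx.
    by apply/existsP; exists (c u); rewrite /= eqxx.
  have center t : t != z -> (c t == inord 1) = (f t == t).
    by move=> tz; rewrite /c (negbTE tz) -val_eqE /=; case: ifP; rewrite !inordK.
  have [fuu | fuu] := eqVneq (f u) u.
    have fvv : f v != v by rewrite -fuv fuu.
    exists [:: v].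
      rewrite /simple_path /= inE uv eqxx !andbT e_sym.
      by move: fv; rewrite (negbTE fvv) -fuv fuu.
    by apply/existsP; exists (inord 1); rewrite /= !center // fuu eqxx (negbTE fvv).
  rewrite (negbTE fuu) /= in fu.
  have [fvv | fvv] := eqVneq (f v) v.
    exists [:: v].
      by rewrite /simple_path /= inE uv eqxx !andbT -fvv -fuv.
    by apply/existsP; exists (inord 1); rewrite /= !center // fvv eqxx (negbTE fuu).
  rewrite (negbTE fvv) /= in fv.
  exists [:: f u; v].
    rewrite /simple_path /= !inE negb_or uv eqxx fu /= fuv e_sym fv fvv.
    by rewrite -fuv eq_sym fuu.
  apply/existsP; exists (inord 1).
  by rewrite /= !center // ffu eqxx (negbTE fuu) (negbTE fvv).
(* Keep only the edges inside stars and those at [z]. The graph stays connected, and [f] is constant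
   along any path avoiding [z], so a path between distinct stars meets [z], whose colour is
   unique. *)
pose e' : rel T := [rel x y | e x y && [|| x == z, y == z | f x == f y]].
have e'_csym : connect_sym e'.
  apply: sym_connect_sym => x y; rewrite /e' /= e_sym (eq_sym (f x)).
  by case: (x == z); case: (y == z).
have to_z t : t != z -> connect e' t z.
  have to_center s : s != z -> connect e' s (f s).
    move=> sz; have [_ ffs /orP[/eqP<-|es]] := fP s sz; first by rewrite ffs.
    by apply: connect1; rewrite /e' /= es ffs eqxx !orbT.
  move=> tz; have [y [yz fy eyz]] := zP t tz.
  apply: connect_trans (to_center t tz) _; rewrite -fy.
  apply: (@connect_trans _ _ y); first by rewrite e'_csym to_center.
  by apply: connect1; rewrite /e' /= eyz eqxx orbT.
have /connectP[p0 ep0 vE] : connect e' u v.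
  by apply: connect_trans (to_z u uz) _; rewrite e'_csym to_z.
case/shortenP: ep0 vE => p ep Up _ vE; exists p.
  rewrite /simple_path Up vE eqxx andbT /= andbT.
  by apply: sub_path ep => x y /= /andP[].
apply: through_z => //; apply: contraNT fuv => zp; rewrite vE.
have {vE vz fvz ffv fv Up uz fuz ffu fu} := ep; elim: p u zp {ep} => //= y p IHp x zxp.
move=> /andP[/andP[_ /or3P[/eqP xz | /eqP yz | /eqP ->]] yp].
- by rewrite xz mem_head in zxp.
- by rewrite yz !inE eqxx orbT in zxp.
- by apply: IHp yp; move: zxp; rewrite inE negb_or => /andP[].
Qed.

(** * The upper bound: finding the star partition *)

Lemma crossing_edge (A : pred T) a b : connected_graph e ->
  A a -> ~~ A b -> exists x y, [/\ A x, ~~ A y & e x y].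
Proof.
move=> conn Aa; have /connectP[p ep ->] := conn a b.
elim: p a Aa ep => [|y p IHp] a Aa /=; first by rewrite Aa.
move=> /andP[eay ep]; have [Ay | nAy _] := boolP (A y); first exact: IHp ep.
by exists a, y.
Qed.

(** Vertices outside [W] are easy to place: around [z = x] the neighbours of [x] can be one-vertex
    stars, and around a neighbour [z = y] they can be leaves of a star centred at [x]. The cases
    below place the at most three vertices of [W]. *)
Lemma nearly_dominating_colorable x : connected_graph e ->
  #|[set w | (w != x) && ~~ e x w]| <= 3 -> cf_colorable e 3.
Proof.
move=> conn; set W := [set w | _] => W3.
have inW w : (w \in W) = (w != x) && ~~ e x w by rewrite inE.
have xW : x \notin W by rewrite inW eqxx.
have NxW y : e x y -> y \notin W by rewrite inW => ->; rewrite andbF.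
have neqW w t : w \in W -> t \notin W -> (w == t = false) * (t == w = false).
  by move=> wW tW; rewrite eq_sym; case: eqP => [tw|//]; rewrite tw wW in tW.
have Nx_neq y : e x y -> y != x by apply: contraTneq => ->; rewrite e_irr.
have Nx_notinW v : v != x -> v \notin W -> e x v.
  by rewrite inW negb_and negbK => /negbTE-> /=; rewrite negbK.
(* The vertices at distance more than 2 from [x]. If there are none, take [z = x] and attach each
   vertex of [W] to a neighbour of [x]. *)
pose far w := (w \in W) && ~~ [exists y, e x y && e y w].
have [/existsP[w0 far0] | /existsPn no_far] := boolP [exists w, far w]; last first.
  have near v : v \in W -> exists2 y, [pick y | e x y && e y v] = Some y & e x y && e y v.
    move=> vW; have := no_far v; rewrite /far vW negbK => /existsP[y xyv].
    by case: pickP => [y' | /(_ y)]; [exists y' | rewrite xyv].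
  pose f v := if v \in W then odflt v [pick y | e x y && e y v] else v.
  apply: (@star_partition_colorable x f) => // v vx; rewrite /f.
    case: ifP => [/near[y -> /andP[xy yv]] /= | ->]; last by rewrite eqxx.
    by rewrite (negbTE (NxW y xy)) Nx_neq // e_sym yv orbT.
  case: ifP => [/near[y -> /andP[xy yv]] /= | /negbT vW].
    by exists y; rewrite (negbTE (NxW y xy)) Nx_neq // e_sym.
  by exists v; rewrite (negbTE vW) vx e_sym Nx_notinW.
have nfarx : ~~ far x by rewrite /far (negbTE xW).
(* Otherwise some edge leaves the far set, giving a path [x], [y], [w1], [w2] with [w1] at distance
   2 from [x]. *)
have [w2 [w1 [/andP[w2W nn2] nfar1 e21]]] := crossing_edge conn far0 nfarx.
have w1x : w1 != x.
  by apply: contraTneq e21 => ->; move: w2W; rewrite inW e_sym => /andP[].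
have w1W : w1 \in W.
  rewrite inW w1x; apply: contra nn2 => xw1.
  by apply/existsP; exists w1; rewrite xw1 e_sym.
have /existsP[y /andP[xy yw1]] : [exists y, e x y && e y w1].
  by move: nfar1; rewrite /far w1W negbK.
have w12 : w1 != w2 by apply: contraTneq e21 => ->; rewrite e_irr.
have yW := NxW y xy; have yx := Nx_neq y xy; have xny : x != y by rewrite eq_sym.
(* When [W] has only two vertices, [w3] is [w1]; this falls under the case [e y w3] below. *)
have [w3 [w3W w32 W_enum]] : exists w3,
    [/\ w3 \in W, w3 != w2 & forall w, w \in W -> [\/ w = w1, w = w2 | w = w3]].
  have : #|W :\ w1 :\ w2| <= 1.
    have w2W1 : w2 \in W :\ w1 by rewrite !inE eq_sym w12 -inW.
    by move: W3; rewrite (cardsD1 w1) w1W (cardsD1 w2 (W :\ w1)) w2W1 !add1n !ltnS.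
  rewrite leq_eqVlt ltnS leqn0 cards_eq0 => /orP[/cards1P[w3 w3E] | /eqP W0].
    have : w3 \in W :\ w1 :\ w2 by rewrite w3E inE.
    rewrite 2!in_setD1 => /and3P[w32 _ w3W]; exists w3; split=> // w wW.
    have : (w \in W :\ w1 :\ w2) = (w == w3) by rewrite w3E inE.
    rewrite 2!in_setD1 wW andbT; have [->|_] := eqVneq w w2; first by constructor 2.
    by have [->|_] := eqVneq w w1; [constructor 1 | move/esym/eqP; constructor 3].
  exists w1; split=> // w wW; have /setP/(_ w) := W0.
  rewrite 2!in_setD1 wW andbT in_set0; have [->|_] := eqVneq w w2; first by constructor 2.
  by have [->|] := eqVneq w w1; first by constructor 1.
(* Take [z = y], with one star on [W] centred at [t], reaching [y] through [w1], and one on the rest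
   centred at [x]. *)
have W_star t : t \in W -> (forall w, w \in W -> (t == w) || e w t) -> cf_colorable e 3.
  move=> tW t_center; pose f v := if v \in W then t else x.
  apply: (@star_partition_colorable y f) => // v vy; rewrite /f.
    case: ifP => [vW | /negbT vW].
      by rewrite tW (neqW t y) // t_center.
    rewrite (negbTE xW) xny eq_sym; split=> //.
    by have [//|vx] := eqVneq v x; rewrite e_sym Nx_notinW.
  case: ifP => [vW | _]; first by exists w1; rewrite w1W (neqW w1 y) // e_sym.
  by exists x; rewrite (negbTE xW) xny.
have [yw3 | nyw3] := boolP (e y w3).
  (* Again [z = y]: [w2] hangs on [w1], [w3] is its own centre, and the rest forms a star at [x]. *)
  pose f v := if v == w2 then w1 else if v \in W then v else x.
  apply: (@star_partition_colorable y f) => // v vy; rewrite /f.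
    have [-> | vw2] := eqVneq v w2.
      by rewrite (negbTE w12) w1W (neqW w1 y) // e21 orbT.
    case: ifP => [vW | /negbT vW]; first by rewrite (negbTE vw2) vW eqxx.
    rewrite (neqW w2 x) // (negbTE xW) xny; split=> //.
    by rewrite eq_sym; have [//|vx] := eqVneq v x; rewrite e_sym Nx_notinW.
  have [_ | vw2] := eqVneq v w2.
    by exists w1; rewrite (negbTE w12) w1W (neqW w1 y) // e_sym.
  case: ifP => [vW | _]; last by exists x; rewrite (neqW w2 x) // (negbTE xW) xny.
  exists v; rewrite (negbTE vw2) vW vy; split=> //; rewrite e_sym.
  by case: (W_enum v vW) vw2 => -> //; rewrite eqxx.
(* Now [w3] is not [w1], and by connectedness it has a neighbour [u]. If [u] is in [W], then [u] is
   [w1] or [w2] and is adjacent to the rest of [W]. *)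
have [_ [u [/eqP-> uw3 ew3u]]] : exists a b, [/\ a == w3, b != w3 & e a b].
  by apply: (@crossing_edge (pred1 w3) w3 x) => //=; rewrite ?eqxx // (neqW w3 x).
have ux : u != x.
  by apply: contraTneq ew3u => ->; move: w3W; rewrite inW e_sym => /andP[].
have [uW | uW] := boolP (u \in W).
  case: (W_enum u uW) => uE; subst u; last by rewrite eqxx in uw3.
    by apply: (W_star w1) => // w /W_enum[] ->; rewrite ?eqxx ?e21 ?ew3u ?orbT.
  by apply: (W_star w2) => // w /W_enum[] ->; rewrite ?eqxx ?(e_sym w1) ?e21 ?ew3u ?orbT.
have xu := Nx_notinW u ux uW.
have w13 : w1 != w3 by apply: contraNneq nyw3 => <-.
have uy : u != y by apply: contraNneq nyw3 => <-; rewrite e_sym.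
(* Here [z = x]: [w3] hangs on [u], while [w2] and [y] hang on [w1]. This last centre is not
   adjacent to [x], but its leaf [y] is. *)
pose f v := if v == w3 then u else if (v == w2) || (v == y) then w1 else v.
have fu : f u = u by rewrite /f (neqW w3 u) // (neqW w2 u) // (negbTE uy).
have fw1 : f w1 = w1 by rewrite /f (negbTE w13) (negbTE w12) (neqW w1 y).
have fy : f y = w1 by rewrite /f (neqW w3 y) // eqxx orbT.
have fw3 : f w3 = u by rewrite /f eqxx.
have f2y v : v != w3 -> (v == w2) || (v == y) -> f v = w1.
  by rewrite /f => /negbTE-> ->.
have f_id v : v != w3 -> ~~ ((v == w2) || (v == y)) -> f v = v.
  by rewrite /f => /negbTE-> /negbTE->.
apply: (@star_partition_colorable x f) => // v vx.
  have [-> | v3] := eqVneq v w3; first by rewrite fw3 fu ux ew3u orbT.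
  have [v2y | v2y] := boolP ((v == w2) || (v == y)); last by rewrite !f_id ?vx ?eqxx.
  by rewrite f2y // fw1 w1x; case/orP: v2y => /eqP->; rewrite ?e21 ?yw1 orbT.
have [-> | v3] := eqVneq v w3; first by exists u; rewrite fu fw3 e_sym.
have [v2y | v2y] := boolP ((v == w2) || (v == y)).
  by exists y; rewrite fy f2y // e_sym.
have [vW | vW] := boolP (v \in W); last by exists v; rewrite vx e_sym Nx_notinW.
case: (W_enum v vW) v3 v2y => -> v3; rewrite ?eqxx //.
  by exists y; rewrite fy fw1 e_sym.
by rewrite eqxx in v3.
Qed.

End ConflictFree.

Theorem theorem3 (T : finType) (e : rel T) (n : nat)
    (e_sym : symmetric e) (e_irr : irreflexive e)
    (conn : connected_graph e) (order_n : #|T| = n)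
    (two_cut : 2 <= #|[set v | cut_vertex e v]|)
    (Delta_lower : n <= max_degree e + 4)
    (Delta_upper : max_degree e + 2 <= n) :
  vcfc conn = 3.
Proof.
have [u [v [cut_u cut_v uv]]] : exists u v, [/\ cut_vertex e u, cut_vertex e v & u != v].
  by have /card_gt1P[u [v []]] := two_cut; rewrite !inE; exists u, v.
have color3 : cf_colorable e 3.
  have T_gt0 : 0 < #|T| by apply/card_gt0P; exists u.
  have [x degx] := eq_bigmax (degree e) T_gt0.
  apply: (@nearly_dominating_colorable _ _ e_sym e_irr x) => //.
  (* The complement of the closed neighbourhood of [x] has [n - 1 - max_degree e] vertices, hence at
     most 3. *)
  have -> : [set w | (w != x) && ~~ e x w] = ~: (x |: [set y | e x y]).
    by apply/setP => w; rewrite !inE negb_or.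
  rewrite cardsCs setCK cardsU1 !inE e_irr order_n.
  by move: Delta_lower; rewrite /max_degree degx /degree leq_subLR add1n addSnnS.
rewrite /vcfc; case: ex_minnP => m color_m min_m.
apply/eqP; rewrite eqn_leq min_m //=.
exact: two_cut_vertices_colorable conn uv cut_u cut_v color_m.
Qed.
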